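(* For every integer $k\geq 1$, $$GR_k(K_{4}+e)=\begin{cases} 17^{k/2}+1, & \text{if $k$ is even},\\ 4\cdot 17^{(k-1)/2}+1, & \text{if $k$ is odd}.\end{cases}$$
   Context: $K_4+e$ denotes the graph on five vertices consisting of a $K_4$ together with a pendant edge (an extra vertex joined to exactly one vertex of the $K_4$). A $k$-edge-coloring of a graph is a map from its edge set to $[k]$. A Gallai-$k$-coloring is a $k$-edge-coloring of a complete graph containing no rainbow triangle (triangle with three distinct colors). $GR_k(H)$ is the minimum integer $N$ such that every Gallai-$k$-coloring of $K_N$ contains a monochromatic copy of $H$. *)

(* Defs.v *)
From mathcomp Require Import all_boot.

Set Implicit Arguments.
Unset Strict Implicit.
Unset Printing Implicit Defensive.

Record sgraph := SGraph {
  vertex :> finType;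
  adj : rel vertex;
  adj_sym : symmetric adj;
  adj_irrefl : irreflexive adj }.

Definition is_edge (G : sgraph) (e : {set G}) : bool :=
  [exists x, exists y, adj x y && (e == [set x; y])].

Definition edge (G : sgraph) := {e : {set G} | is_edge e}.

Definition edge_coloring (k : nat) (G : sgraph) := edge G -> 'I_k.

Definition complete_adj (N : nat) : rel 'I_N := fun x y => x != y.

Lemma complete_sym N : symmetric (@complete_adj N).
Proof. by move=> x y; rewrite /complete_adj eq_sym. Qed.

Lemma complete_irrefl N : irreflexive (@complete_adj N).
Proof. by move=> x; rewrite /complete_adj eqxx. Qed.

Definition complete (N : nat) : sgraph :=
  SGraph (@complete_sym N) (@complete_irrefl N).

(* The K_4 lives on the vertices 0, 1, 2, 3; the pendant edge is {3, 4}. *)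
Definition K4e_adj : rel 'I_5 := fun x y =>
  [|| [&& x != y, x < 4 & y < 4],
      (x == 3 :> nat) && (y == 4 :> nat)
    | (x == 4 :> nat) && (y == 3 :> nat)].

Lemma K4e_sym : symmetric K4e_adj.
Proof.
move=> x y; rewrite /K4e_adj eq_sym [(x < 4) && _]andbC.
by rewrite [(x == 3 :> nat) && _]andbC [(x == 4 :> nat) && _]andbC [X in _ || X]orbC.
Qed.

Lemma K4e_irrefl : irreflexive K4e_adj.
Proof. by move=> x; rewrite /K4e_adj eqxx; case: (nat_of_ord x) => [|[|[|[|[]]]]]. Qed.

Definition K4e : sgraph := SGraph K4e_sym K4e_irrefl.

(* [x], [y], [z] are automatically distinct, as edges are not loops. *)
Definition rainbow_triangle k (G : sgraph) (c : edge_coloring k G) : Prop :=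
  exists (x y z : G) (exy eyz exz : edge G),
    [/\ val exy = [set x; y], val eyz = [set y; z], val exz = [set x; z]
      & uniq [:: c exy; c eyz; c exz]].

(* Copies are subgraphs, not necessarily induced; the existence of the edge [e]
   of [G] expresses that [f] maps edges of [H] to edges of [G]. *)
Definition mono_copy (H : sgraph) k (G : sgraph) (c : edge_coloring k G) : Prop :=
  exists (f : H -> G) (i : 'I_k), injective f /\
    forall x y : H, adj x y ->
      exists2 e : edge G, val e = [set f x; f y] & c e = i.

Definition gallai_coloring k N (c : edge_coloring k (complete N)) : Prop :=
  ~ rainbow_triangle c.

Definition gallai_arrows (k : nat) (H : sgraph) (N : nat) : Prop :=
  forall c : edge_coloring k (complete N), gallai_coloring c -> mono_copy H c.

(* [is_GR k H N] reads GR_k(H) = N. *)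
Definition is_GR (k : nat) (H : sgraph) (N : nat) : Prop :=
  gallai_arrows k H N /\ forall M, gallai_arrows k H M -> N <= M.

(* Main.v *)
Require Import Defs.
From mathcomp Require Import all_boot zify.

(* Upper bound: by Gallai's theorem the vertices split into homogeneous parts
   joined by one or two colours, so one inducts on the number of vertices.
   A part with a neighbour in colour [i] has a smaller clique number in [i], so
   the induction needs triangle-free colours too: with [a] colours free of
   [K_4+e], [b] colours free of triangles and the others absent, there are at
   most [A(a) B(b)] vertices, where [A(2m) = 17^m], [A(2m+1) = 4 * 17^m],
   [B(2m) = 5^m] and [B(2m+1) = 2 * 5^m].  The pendant edge matters only when a
   colour crossing between parts contains a [K_4]: that [K_4] is a component of
   a colour linking all the parts, and then it is everything.
   Lower bound: blow up Paley colourings of order 17 with new colours; for odd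
   [k] the innermost copies are monochromatic [K_4]'s, which stay components of
   the last colour. *)

Set Implicit Arguments.
Unset Strict Implicit.
Unset Printing Implicit Defensive.

(** * Clique-free sets and small Ramsey numbers *)

Section CliqueFree.
Variables (V : finType) (e : rel V).
Implicit Types S P Q K : {set V}.

Definition nbhd S x := [set y in S | e x y].

(* [kfree n S]: the graph [e] has no clique on [n] vertices in [S]. *)
Fixpoint kfree n S :=
  if n is m.+1 then [forall x in S, kfree m (nbhd S x)] else false.

Definition clique K := {in K &, forall x y, x != y -> e x y}.

(** A copy of K_4+e is a 4-clique with an edge leaving it, so freeness means that every 4-clique of
    [S] is closed under [e] in [S]. *)
Definition K4e_free S :=
  forall K, K \subset S -> #|K| = 4 -> clique K ->
  {in K & S, forall x y, e x y -> y \in K}.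

Lemma nbhdS S P x : P \subset S -> nbhd P x \subset nbhd S x.
Proof.
move=> /subsetP sPS; apply/subsetP => y; rewrite !inE => /andP[/sPS -> ->] //.
Qed.

Lemma kfreeS n S P : P \subset S -> kfree n S -> kfree n P.
Proof.
elim: n S P => //= n IHn S P sPS /forall_inP fS; apply/forall_inP => x Px.
by apply: (IHn (nbhd S x)); [exact: nbhdS | apply/fS/(subsetP sPS)].
Qed.

Lemma kfree1 S : kfree 1 S = (S == set0).
Proof.
apply/forall_inP/eqP => [fS | -> x]; last by rewrite inE.
by apply/setP => x; rewrite inE; apply/negP => /fS.
Qed.

(** A clique of [P] and a clique of [Q] unite to one of [S]. The induction passes to the
    neighbourhood of a vertex of [P] at which [kfree] fails; in [S] this neighbourhood keeps all of
    [Q]. *)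
Lemma kfree_join p q S P Q : P \subset S -> Q \subset S ->
  {in P & Q, forall x y, e x y} -> kfree (p + q) S -> kfree p P || kfree q Q.
Proof.
elim: p S P => [|p IHp] S P sPS sQS ePQ /= fS.
  by rewrite (kfreeS sQS).
case: (boolP [forall x in P, _]) => //= /forall_inPn[x Px NfPx].
move/forall_inP/(_ x (subsetP sPS x Px)): fS => fS.
have := IHp _ (nbhd P x) (nbhdS x sPS) _ _ fS; rewrite (negbTE NfPx); apply.
  by apply/subsetP => y Qy; rewrite inE (subsetP sQS) // ePQ.
by move=> y z; rewrite inE => /andP[Py _]; apply: ePQ.
Qed.

Lemma K4e_freeS S P : P \subset S -> K4e_free S -> K4e_free P.
Proof.
move=> sPS fS K sKP cK clK x y Kx Py.
by apply: fS => //; [exact: subset_trans sPS | exact: (subsetP sPS)].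
Qed.

Hypotheses (e_sym : symmetric e) (e_irr : irreflexive e).

Lemma kfreePn n S : ~~ kfree n S ->
  exists K, [/\ K \subset S, #|K| = n & clique K].
Proof.
elim: n S => [|n IHn] S /=.
  by exists set0; rewrite sub0set cards0; split=> // x y; rewrite inE.
case/forall_inPn => x Sx /IHn[K [sKS cK clK]].
have eK y : y \in K -> e x y by move/(subsetP sKS); rewrite inE => /andP[].
exists (x |: K); split.
- rewrite subUset sub1set Sx; apply: subset_trans sKS _.
  by apply/subsetP => y; rewrite inE => /andP[].
- by rewrite cardsU1 cK; case: (boolP (x \in K)) => // /eK; rewrite e_irr.
move=> y z /setU1P[-> | Ky] /setU1P[-> | Kz]; rewrite ?eqxx //; last exact: clK.
- by rewrite eK.
- by rewrite e_sym eK.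
Qed.

(** Splitting each degree into later and earlier neighbours counts every edge once in each half. *)
Lemma handshake S : ~~ odd (\sum_(x in S) #|nbhd S x|).
Proof.
pose lt (x y : V) : bool := enum_rank x < enum_rank y.
have split_deg x : x \in S -> #|nbhd S x| =
    \sum_(y in S) (e x y && lt x y) + \sum_(y in S) (e y x && lt y x).
  move=> _; rewrite -big_split -sum1_card /= big_mkcond [RHS]big_mkcond /=.
  apply: eq_bigr => y _; rewrite inE; case: (y \in S) => //=.
  rewrite (e_sym y); case exy: (e x y) => //=; rewrite /lt.
  case: ltngtP => // /ord_inj/enum_rank_inj xy.
  by rewrite xy e_irr in exy.
rewrite (eq_bigr _ split_deg) big_split /= oddD.
by rewrite [X in _ (+) odd X]exchange_big addbb.
Qed.

End CliqueFree.

(** Since [N] bounds the order of a good colouring, this says R(p,q) <= N + 1. *)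
Definition ramsey p q N := forall (V : finType) (r b : rel V) (T : {set V}),
  symmetric r -> symmetric b -> irreflexive r -> irreflexive b ->
  {in T &, forall x y, x != y -> r x y || b x y} ->
  kfree r p T -> kfree b q T -> #|T| <= N.

Lemma ramseyC p q N : ramsey p q N -> ramsey q p N.
Proof.
move=> R V r b T rs bs ri bi rb fr fb; apply: (R V b r T) => // x y Tx Ty xy.
by rewrite orbC rb.
Qed.

Lemma ramsey1 q : ramsey 1 q 0.
Proof. by move=> V r b T _ _ _ _ _; rewrite kfree1 => /eqP->; rewrite cards0. Qed.

Lemma two_colour_degree (V : finType) (r b : rel V) (T : {set V}) x :
  {in T &, forall x y, x != y -> r x y || b x y} -> x \in T ->
  #|T| <= 1 + #|nbhd r T x| + #|nbhd b T x|.
Proof.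
move=> rb Tx; rewrite -(cards1 x).
apply: leq_trans (leq_add (leq_card_setU _ _) (leqnn _)).
apply: leq_trans (leq_card_setU _ _); apply/subset_leq_card/subsetP => y Ty.
rewrite !inE Ty /=; case: eqVneq => //= yx; apply: rb => //.
by rewrite eq_sym.
Qed.

Lemma two_colour_nbhd (V : finType) (r b f : rel V) (T : {set V}) x :
  {in T &, forall x y, x != y -> r x y || b x y} ->
  {in nbhd f T x &, forall x y, x != y -> r x y || b x y}.
Proof. by move=> rb y z; rewrite !inE => /andP[Ty _] /andP[Tz _]; apply: rb. Qed.

Lemma kfree_nbhd (V : finType) (r f : rel V) n (T : {set V}) x :
  kfree r n T -> kfree r n (nbhd f T x).
Proof. by apply: kfreeS; apply/subsetP => y; rewrite inE => /andP[]. Qed.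

(** The classical recursion R(p,q) <= R(p-1,q) + R(p,q-1), from the two neighbourhoods of one
    vertex; the summand 1 is that vertex. *)
Lemma ramsey_step p q m n :
  ramsey p q.+1 m -> ramsey p.+1 q n -> ramsey p.+1 q.+1 (1 + m + n).
Proof.
move=> Rm Rn V r b T rs bs ri bi rb fr fb.
have [->|[x Tx]] := set_0Vmem T; first by rewrite cards0.
apply: leq_trans (two_colour_degree rb Tx) _; rewrite leq_add ?leq_add2l //.
  apply: (Rm _ r b) => //; [exact: two_colour_nbhd | | exact: kfree_nbhd].
  exact: (forall_inP fr).
apply: (Rn _ r b) => //; [exact: two_colour_nbhd | exact: kfree_nbhd |].
exact: (forall_inP fb).
Qed.

Lemma ramsey_n2 n : ramsey n.+1 2 n.
Proof.
elim: n => [|n IHn]; first exact: ramsey1.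
by have := ramsey_step IHn (ramseyC (@ramsey1 _)); rewrite add1n addn0.
Qed.

Lemma ramsey33 : ramsey 3 3 5.
Proof. exact: (ramsey_step (ramseyC (@ramsey_n2 2)) (@ramsey_n2 2)). Qed.

(* The crude bound is 9, attained only by a 5-regular graph on 9 vertices. *)
Lemma ramsey43 : ramsey 4 3 8.
Proof.
move=> V r b T rs bs ri bi rb fr fb; rewrite leqNgt; apply/negP => T9.
have cT : #|T| = 9.
  by apply/eqP; rewrite eqn_leq T9 (ramsey_step ramsey33 (@ramsey_n2 3) rs bs).
have deg x : x \in T -> #|nbhd r T x| = 5.
  move=> Tx; have : #|nbhd r T x| <= 5.
    apply: (ramsey33 rs bs) => //; [exact: two_colour_nbhd | | exact: kfree_nbhd].
    exact: (forall_inP fr).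
  have := two_colour_degree rb Tx.
  have : #|nbhd b T x| <= 3.
    apply: (ramsey_n2 rs bs) => //; [exact: two_colour_nbhd | exact: kfree_nbhd |].
    exact: (forall_inP fb).
  lia.
by have := handshake rs ri T; rewrite (eq_bigr _ deg) sum_nat_const cT.
Qed.

Lemma ramsey44 : ramsey 4 4 17.
Proof. exact: (ramsey_step (ramseyC ramsey43) ramsey43). Qed.

Arguments kfree : simpl never.

(** * Connected colours and Gallai partitions *)

Section Gallai.
Variables (V : finType) (k : nat) (c : V -> V -> 'I_k).
Hypothesis c_sym : forall x y, c x y = c y x.
Hypothesis gallai : forall x y z, x != y -> y != z -> x != z ->
  [\/ c x y = c y z, c y z = c x z | c x y = c x z].
Implicit Types (S T : {set V}) (X : {set 'I_k}).

Definition colour_rel (i : 'I_k) : rel V := [rel x y | (x != y) && (c x y == i)].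

Lemma colour_rel_sym i : symmetric (colour_rel i).
Proof. by move=> x y; rewrite /colour_rel /= eq_sym c_sym. Qed.

Lemma colour_rel_irr i : irreflexive (colour_rel i).
Proof. by move=> x; rewrite /colour_rel /= eqxx. Qed.

Definition link X S : rel V :=
  [rel x y | [&& x \in S, y \in S, x != y & c x y \in X]].

Lemma link_sym X S : connect_sym (link X S).
Proof. by apply: sym_connect_sym => x y; rewrite /link /= eq_sym c_sym andbCA. Qed.

Lemma link_in X S x y : connect (link X S) x y -> (x \in S) = (y \in S).
Proof. by apply: closed_connect => z w /and4P[-> ->]. Qed.

Definition connected X S := [forall x in S, forall y in S, connect (link X S) x y].

Lemma connectedP X S :
  reflect {in S &, forall x y, connect (link X S) x y} (connected X S).
Proof.
apply: (iffP forall_inP) => [h x y Sx Sy | h x Sx].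
  exact: (forall_inP (h x Sx)).
by apply/forall_inP => y; apply: h.
Qed.

Lemma connected_leave X S (U : {set V}) x y : connected X S ->
  x \in U -> y \notin U -> x \in S -> y \in S ->
  exists u v, [/\ u \in S, v \in S, u \in U, v \notin U & c u v \in X].
Proof.
move=> /connectedP cXS Ux Uy Sx Sy.
case: (boolP [exists u, exists v,
   [&& u \in S, v \in S, u \in U, v \notin U & c u v \in X]]).
  by case/existsP => u /existsP[v /and5P[]]; exists u, v.
move=> /existsPn noE; suff cl : closed (link X S) U.
  by have := closed_connect cl (cXS x y Sx Sy); rewrite Ux (negbTE Uy).
apply: intro_closed; first exact: link_sym.
move=> u v /and4P[Su Sv _ cuv] Uu; apply: contraT => Uv.
by have /existsPn/(_ v) := noE u; rewrite Su Sv Uu Uv cuv.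
Qed.

Lemma cross_neq X S x y : ~~ connect (link X S) x y -> x != y.
Proof. by apply: contraNneq => ->; rewrite connect0. Qed.

Lemma cross_notin X S x y : x \in S -> y \in S ->
  ~~ connect (link X S) x y -> c x y \notin X.
Proof.
move=> Sx Sy ncxy; apply: contra ncxy => cX.
case: (eqVneq x y) => [->|xy]; first exact: connect0.
by apply: connect1; rewrite /link /= Sx Sy xy.
Qed.

(** Along an edge [x u] of the component, the colours from [z] to [x] and to [u] lie outside [X]
    while that of [x u] lies in [X]. With no rainbow triangle the first two must agree. *)
Lemma component_module X S x y z : z \in S -> ~~ connect (link X S) x z ->
  connect (link X S) x y -> c z x = c z y.
Proof.
move=> Sz nxz /connectP[p pth ->]; elim: p x nxz pth => //= u p IHp x nxz.
case/andP => exu pth; have cxu := connect1 exu.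
have nuz : ~~ connect (link X S) u z.
  by apply: contra nxz; apply: connect_trans.
rewrite -(IHp u nuz pth); case/and4P: exu => Sx Su xu cX.
have [nX nU] := (cross_notin Sx Sz nxz, cross_notin Su Sz nuz).
case: (gallai xu (cross_neq nuz) (cross_neq nxz)) => E.
- by rewrite -E cX in nU.
- by rewrite ![c z _]c_sym E.
- by rewrite -E cX in nX.
Qed.

(* A vertex [v] reaches every [i]-component of [S :\ v] by an edge of colour [i];
   so if [c v y] is [j != i], then all other components are joined to [y] in
   colour [j], which leaves no room for a third colour at [v]. *)
Lemma no_split S v i j l y z : v \in S -> i != j -> i != l -> j != l ->
  connected [set i] S -> ~~ connected [set i] (S :\ v) ->
  y \in S :\ v -> c v y = j -> z \in S :\ v -> c v z = l -> False.
Proof.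
set T := S :\ v => Sv ij il jl cS ncT Ty vy Tz vz.
pose e := link [set i] T.
have [t1 [t2 [T1 T2 n12]]] :
    exists t1 t2, [/\ t1 \in T, t2 \in T & ~~ connect e t1 t2].
  case/forall_inPn: ncT => t1 T1 /forall_inPn[t2 T2 n12].
  by exists t1, t2.
have reach t : t \in T -> exists2 x, connect e t x & c v x = i.
  move=> Tt; pose U := [set x | connect e t x].
  have TU x : x \in U -> x \in T by rewrite inE => /link_in <-.
  have nUv : v \notin U by apply/negP => /TU; rewrite !inE eqxx.
  have Ut : t \in U by rewrite inE connect0.
  have St : t \in S by move: Tt; rewrite inE => /andP[].
  have [u [w [Su Sw Uu Uw]]] := connected_leave cS Ut nUv St Sv.
  rewrite inE => /eqP cuw; have [wv|wv] := eqVneq w v.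
    by exists u; [move: Uu; rewrite inE | rewrite c_sym -wv].
  have uw : u != w by apply: contraNneq Uw => <-.
  case/negP: Uw; move: (Uu); rewrite !inE => ctu; apply: connect_trans ctu _.
  by apply: connect1; rewrite /e /link /= TU // !inE wv Sw cuw eqxx uw.
have key m w t : i != m -> w \in T -> c v w = m -> t \in T ->
    ~~ connect e t w -> c w t = m.
  move=> im Tw vw Tt ntw; have [x ctx vx] := reach t Tt.
  have nxw : ~~ connect e x w by apply: contra ntw; apply: connect_trans.
  have Tx : x \in T by rewrite -(link_in ctx).
  have cxw : c x w != i.
    by have := cross_notin Tx Tw nxw; rewrite inE.
  rewrite (component_module Tw ntw ctx) c_sym.
  have vNT s : s \in T -> v != s.
    by rewrite !inE => /andP[]; rewrite eq_sym.
  have [E|E|E] := gallai (vNT x Tx) (cross_neq nxw) (vNT w Tw).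
  - by rewrite -E vx eqxx in cxw.
  - by rewrite E.
  - by move: im; rewrite -vw -E vx eqxx.
(* In different components, [y] and [z] would be joined in both [j] and [l]. In a common one, a
   vertex [t] of another component sees [y] in [j] and [z] in [l], against [component_module]. *)
have [czy | nzy] := boolP (connect e z y); last first.
  have yz := key _ _ _ ij Ty vy Tz nzy.
  have zy := key _ _ _ il Tz vz Ty; rewrite link_sym nzy in zy.
  by move: jl; rewrite -yz -(zy isT) c_sym eqxx.
have [t Tt nty] : exists2 t, t \in T & ~~ connect e t y.
  have [c1y|] := boolP (connect e t1 y); last by exists t1.
  exists t2 => //; apply: contra n12 => c2y.
  by apply: connect_trans c1y _; rewrite link_sym.
have ntz : ~~ connect e t z by apply: contra nty => h; apply: connect_trans h czy.
have nzt : ~~ connect e z t by rewrite link_sym.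
have := component_module Tt nzt czy.
rewrite ![c t _]c_sym (key _ _ _ ij Ty vy Tt nty) (key _ _ _ il Tz vz Tt ntz).
by move/esym/eqP; rewrite (negbTE jl).
Qed.

(** Induction by deleting a vertex [v], which has edges of all three colours. One of the colours
    becomes disconnected, and [no_split] applies to it. If only one vertex remains, [v] has a single
    edge, too few for two colours. *)
Lemma no_three_connected S i j l : 1 < #|S| -> i != j -> i != l -> j != l ->
  ~~ [&& connected [set i] S, connected [set j] S & connected [set l] S].
Proof.
have [n leSn] := ubnP #|S|; elim: n S leSn => // n IHn S leSn S1 ij il jl.
apply/negP => /and3P[ci cj cl].
have [v Sv] : exists v, v \in S by apply/card_gt0P; apply: ltnW.
have cT : #|S| = #|S :\ v|.+1 by rewrite (cardsD1 v) Sv.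
have [t Tt] : exists t, t \in S :\ v by apply/card_gt0P; rewrite cT in S1.
have out m : connected [set m] S -> exists2 y, y \in S :\ v & c v y = m.
  move=> cm; have vv : v \in [set v] by rewrite inE.
  have [tv St] := setD1P Tt; have ntv : t \notin [set v] by rewrite inE.
  have [u [w [Su Sw]]] := connected_leave cm vv ntv Sv St.
  by rewrite !inE => /eqP-> wv /eqP cm'; exists w; rewrite // !inE wv.
have [[yi Ti vi] [yj Tj vj]] := (out i ci, out j cj).
have [yl Tl vl] := out l cl.
have [T1|T1] := ltnP 1 #|S :\ v|; last first.
  have /cards1P[s Ts] : #|S :\ v| == 1.
    by rewrite eqn_leq T1; apply/card_gt0P; exists t.
  move: Ti Tj; rewrite Ts !inE => /eqP yis /eqP yjs.
  by move: ij; rewrite -vi -vj yis yjs eqxx.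
have := IHn (S :\ v) _ T1 ij il jl; rewrite -ltnS -cT => /(_ leSn).
rewrite !negb_and => /or3P[] nc.
- exact: (no_split Sv ij il jl ci nc Tj vj Tl vl).
- apply: (no_split Sv _ jl il cj nc Ti vi Tl vl); by rewrite eq_sym.
- apply: (no_split Sv _ _ ij cl nc Ti vi Tj vj); by rewrite eq_sym.
Qed.

(** * Components of a colour set and their representatives *)

Section Parts.
Variables (S : {set V}) (X : {set 'I_k}).
Local Notation e := (link X S).

Definition part x := [set y in S | connect e x y].
Definition reps := [set x in S | root e x == x].

Lemma root_in x : (root e x \in S) = (x \in S).
Proof. by rewrite (link_in (connect_root e x)). Qed.

Lemma root_reps x : x \in S -> root e x \in reps.
Proof. by move=> Sx; rewrite inE root_in Sx root_root ?eqxx //; apply: link_sym. Qed.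

Lemma reps_cross x y : x \in reps -> y \in reps -> x != y -> ~~ connect e x y.
Proof.
rewrite !inE => /andP[_ /eqP rx] /andP[_ /eqP ry].
by rewrite -(root_connect (@link_sym X S)) rx ry.
Qed.

Lemma leq_card_parts h :
  (forall x, x \in S -> #|part x| <= h) -> #|S| <= #|reps| * h.
Proof.
move=> leh; rewrite -sum1_card (partition_big (root e) (mem reps)) /=; last first.
  exact: root_reps.
rewrite -sum_nat_const; apply: leq_sum => x rx.
have Sx : x \in S by move: rx; rewrite inE => /andP[].
apply: leq_trans (leh x Sx); rewrite sum1_card; apply: subset_leq_card.
apply/subsetP => y; rewrite !inE => /andP[-> /eqP <-].
by rewrite link_sym connect_root.
Qed.

(** A path is projected to the roots: steps inside a component collapse, and a step between
    components has colour [i], which [component_module], applied at both ends, carries over to the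
    roots. *)
Lemma connected_reps i : i \notin X -> connected (i |: X) S ->
  connected [set i] reps.
Proof.
move=> iX /connectedP cS; apply/connectedP => x y rx ry.
have [Sx Sy] : x \in S /\ y \in S by move: rx ry; rewrite !inE => /andP[-> _] /andP[].
have [rtx rty] : root e x = x /\ root e y = y.
  by move: rx ry; rewrite !inE => /andP[_ /eqP->] /andP[_ /eqP].
rewrite -rtx -rty; have /connectP[p pth ->] := cS x y Sx Sy.
elim: p x {rx rtx} Sx pth => [|u p IHp] x Sx /=; first by rewrite connect0.
case/andP => /and4P[_ Su xu cxu] pth; apply: connect_trans (IHp u Su pth).
have [cxuX | nxu] := boolP (connect e x u).
  by rewrite (rootP (@link_sym X S) cxuX).
have cE : c x u = i.
  apply/eqP; move: cxu; rewrite !inE => /orP[//|cX].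
  by have := cross_notin Sx Su nxu; rewrite cX.
have crE : c (root e x) (root e u) = i.
  rewrite -cE [c x u]c_sym.
  have nux : ~~ connect e u x by rewrite link_sym.
  rewrite (component_module Su nxu (connect_root e x)).
  rewrite [RHS]c_sym; apply/esym; apply: (@component_module X S).
  - by rewrite root_in.
  - apply: contra nux => h; apply: connect_trans h _.
    by rewrite link_sym connect_root.
  - exact: connect_root.
apply: connect1; rewrite /link /= !root_reps // crE inE eqxx andbT.
by rewrite (root_connect (@link_sym X S)).
Qed.

Hypothesis disc : ~~ connected X S.

Lemma leave_part x : exists2 y, y \in S & ~~ connect e x y.
Proof.
case/forall_inPn: disc => t1 T1 /forall_inPn[t2 T2 n12].
have [c1y|] := boolP (connect e x t1); last by exists t1.
exists t2 => //; apply: contra n12 => c2y.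
by apply: connect_trans c2y; rewrite link_sym.
Qed.

(** Some edge in [i |: X] leaves the part of [x]. Colours of [X] stay inside parts, so it has colour
    [i], and its inner end may be moved to [x] by [component_module]. *)
Lemma part_neighbour x i : i \notin X -> connected (i |: X) S -> x \in S ->
  exists y, [/\ y \in S, ~~ connect e x y & c x y = i].
Proof.
move=> iX cS Sx; have [t St nt] := leave_part x.
have xP : x \in part x by rewrite inE Sx connect0.
have tP : t \notin part x by rewrite inE St.
have [u [w [Su Sw]]] := connected_leave cS xP tP Sx St.
rewrite !inE Su Sw /= => cxu cxw /orP[/eqP cuw | cX].
  exists w; split=> //; rewrite c_sym -cuw [c u w]c_sym.
  exact: component_module cxw cxu.
have nuw : ~~ connect e u w by apply: contra cxw; apply: connect_trans.
by have := cross_notin Su Sw nuw; rewrite cX.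
Qed.

Lemma reps_gt1 : 1 < #|reps|.
Proof.
case/forall_inPn: disc => t1 T1 /forall_inPn[t2 T2 n12].
rewrite (cardsD1 (root e t1)) root_reps //= add1n ltnS.
apply/card_gt0P; exists (root e t2); rewrite in_setD1 root_reps // andbT.
by rewrite (root_connect (@link_sym X S)) link_sym.
Qed.

End Parts.

(* [X] is a maximal set of colours whose graph is disconnected; any three
   colours outside [X] would all be connected on representatives. *)
Lemma gallai_partition S : 1 < #|S| -> exists X,
  [/\ ~~ connected X S, forall i, i \notin X -> connected (i |: X) S
    & #|~: X| <= 2].
Proof.
move=> S1; have d0 : ~~ connected set0 S.
  have /card_gt1P[x [y [Sx Sy xy]]] := S1.
  apply/negP => c0.
  have xx : x \in [set x] by rewrite inE.
  have yx : y \notin [set x] by rewrite inE eq_sym.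
  by have [u [w [_ _ _ _]]] := connected_leave c0 xx yx Sx Sy; rewrite inE.
have [X /maxsetP[dX maxX] _] := maxset_exists (P := fun X => ~~ connected X S) d0.
have cX i : i \notin X -> connected (i |: X) S.
  move=> iX; apply: contraT => /maxX/(_ (subsetUr _ _)) E.
  by rewrite -E setU11 in iX.
exists X; split=> //; rewrite leqNgt; apply/negP.
case/card_gt2P => i [j [l [[]]]]; rewrite !inE => iX jX lX [ij jl li].
rewrite eq_sym in li.
have := no_three_connected (reps_gt1 dX) ij li jl.
by rewrite !connected_reps //; apply: cX.
Qed.

(** No edge of colour [i] leaves a 4-clique [K]. If [K] is not all of [S], some edge [u w] leaving
    [K] has its colour in [X], so [u] and [w] share a part. A crossing [i]-neighbour [s] of [u] lies
    in [K] and is also joined to [w] in colour [i], a contradiction. *)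
Lemma isolated_K4 S X i : ~~ connected X S -> i \notin X ->
  connected (i |: X) S -> K4e_free (colour_rel i) S ->
  kfree (colour_rel i) 4 S || (#|S| <= 4).
Proof.
move=> dX iX ciX fS; have [//|nfS] := boolP (kfree _ 4 S).
have [K [sKS cK clK]] := kfreePn (colour_rel_sym i) (@colour_rel_irr i) nfS.
rewrite -cK /=; apply/subset_leq_card/subsetP => y Sy; apply: contraT => Ky.
have [x Kx] : exists x, x \in K by apply/card_gt0P; rewrite cK.
have closedK u w : u \in K -> w \in S -> w \notin K -> c u w != i.
  move=> Ku Sw Kw; apply: contra (Kw) => cuw.
  apply: (fS K sKS cK clK u w Ku Sw); rewrite /colour_rel /= cuw andbT.
  by apply: contraNneq Kw => <-.
have Sx := subsetP sKS x Kx.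
have [u [w [Su Sw Ku Kw]]] := connected_leave ciX Kx Ky Sx Sy.
rewrite in_setU1 (negbTE (closedK u w Ku Sw Kw)) /= => cX.
have uw : u != w by apply: contraNneq Kw => <-.
have cuw : connect (link X S) u w by apply: connect1; rewrite /link /= Su Sw uw.
have [s [Ss nus cus]] := part_neighbour dX iX ciX Su.
have /eqP cws : c w s == i.
  by rewrite c_sym -(component_module Ss nus cuw) c_sym cus.
have Ks : s \in K.
  by apply: contraT => Ks; have := closedK u s Ku Ss Ks; rewrite cus eqxx.
by have := closedK s w Ks Sw Kw; rewrite c_sym cws eqxx.
Qed.

End Gallai.

(** * The upper bound *)

Definition gr_bound a b :=
  17 ^ a./2 * (if odd a then 4 else 1) * (5 ^ b./2 * (if odd b then 2 else 1)).

Lemma gr_bound_gt0 a b : 0 < gr_bound a b.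
Proof.
by rewrite !muln_gt0 !expn_gt0 /=; case: (odd a); case: (odd b).
Qed.

Lemma gr_boundSS a b : gr_bound a.+2 b = 17 * gr_bound a b.
Proof. by rewrite /gr_bound /= negbK expnS !mulnA. Qed.

Lemma gr_bound_SS a b : gr_bound a b.+2 = 5 * gr_bound a b.
Proof. by rewrite /gr_bound /= negbK expnS; lia. Qed.

Lemma gr_boundE a b i j : gr_bound (a + i) (b + j) =
  17 ^ a./2 * 5 ^ b./2 * gr_bound (odd a + i) (odd b + j).
Proof.
have shift1 m p q : gr_bound (m.*2 + p) q = 17 ^ m * gr_bound p q.
  by elim: m => [|m IHm]; rewrite ?mul1n // doubleS !addSn gr_boundSS IHm expnS mulnA.
have shift2 m p q : gr_bound p (m.*2 + q) = 5 ^ m * gr_bound p q.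
  by elim: m => [|m IHm]; rewrite ?mul1n // doubleS !addSn gr_bound_SS IHm expnS mulnA.
rewrite -{1}(odd_double_half a) -{1}(odd_double_half b).
by rewrite [odd a + _./2.*2]addnC [odd b + _./2.*2]addnC -!addnA shift1 shift2 mulnA.
Qed.

(* Only the parities of [a] and [b] matter, up to a common factor. *)
Ltac gr_bound_arith a b :=
  clear - a b; rewrite !(gr_boundE a b);
  have : 0 < 17 ^ a./2 * 5 ^ b./2; [by rewrite muln_gt0 !expn_gt0 | idtac];
  move: (17 ^ a./2 * 5 ^ b./2) => w;
  case: (odd a); case: (odd b);
  repeat match goal with |- context [gr_bound ?x ?y] =>
    let v := eval vm_compute in (gr_bound x y) in change (gr_bound x y) with v
  end; lia.


(* Types of colours: 0 edge-free, 1 triangle-free, 2 free of [K_4+e]. *)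
Definition hfree (V : finType) (e : rel V) t (S : {set V}) : Prop :=
  if t is _.+2 then K4e_free e S else kfree e t.+2 S.

Lemma hfreeS (V : finType) (e : rel V) t (S P : {set V}) :
  P \subset S -> hfree e t S -> hfree e t P.
Proof. by case: t => [|[|t]] sPS; [apply: kfreeS | apply: kfreeS | apply: K4e_freeS]. Qed.

Lemma kfree2_edge (V : finType) (e : rel V) (S : {set V}) x y :
  kfree e 2 S -> x \in S -> y \in S -> ~~ e x y.
Proof.
move=> fS Sx Sy; have : kfree e 1 (nbhd e S x) by apply: (forall_inP fS).
by rewrite kfree1 => /eqP/setP/(_ y); rewrite !inE Sy => /= ->.
Qed.

Section Bound.
Variables (V : finType) (k : nat) (c : V -> V -> 'I_k).
Hypothesis c_sym : forall x y, c x y = c y x.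
Hypothesis gallai : forall x y z, x != y -> y != z -> x != z ->
  [\/ c x y = c y z, c y z = c x z | c x y = c x z].
Implicit Types (S P Q : {set V}) (X : {set 'I_k}) (ty : 'I_k -> nat).
Local Notation E := (colour_rel c).

Definition avoids ty S := forall i, hfree (E i) (ty i) S.
Definition nb_type t ty := \sum_i (ty i == t).
Definition type_bound ty := gr_bound (nb_type 2 ty) (nb_type 1 ty).
Definition retype ty i t j := if j == i then t else ty j.

Lemma avoids_retype ty i t S :
  avoids ty S -> hfree (E i) t S -> avoids (retype ty i t) S.
Proof. by move=> aS hS j; rewrite /retype; case: eqVneq => [->|]. Qed.

Lemma retype_le2 ty i t : t <= 2 -> (forall j, ty j <= 2) ->
  forall j, retype ty i t j <= 2.
Proof. by move=> t2 ty2 j; rewrite /retype; case: eqVneq. Qed.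

(** Isolates the contribution of [r], so that the bounds before and after changing its type are
    compared over the same [a] and [b]. *)
Lemma type_bound1 ty r : exists a b,
  type_bound ty = gr_bound (a + (ty r == 2)) (b + (ty r == 1)) /\
  forall t, type_bound (retype ty r t) = gr_bound (a + (t == 2)) (b + (t == 1)).
Proof.
exists (\sum_(i | i != r) (ty i == 2)), (\sum_(i | i != r) (ty i == 1)).
have split_r ty' t : nb_type t ty' = \sum_(i | i != r) (ty' i == t) + (ty' r == t).
  by rewrite /nb_type (bigD1 r) //= addnC.
rewrite /type_bound !split_r; split=> // t; rewrite !split_r /retype eqxx.
by congr (gr_bound (_ + _) (_ + _)); apply: eq_bigr => i /negbTE->.
Qed.

Lemma type_bound2 ty r s : r != s -> exists a b,
  type_bound ty = gr_bound (a + ((ty r == 2) + (ty s == 2)))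
                           (b + ((ty r == 1) + (ty s == 1))) /\
  forall t u, type_bound (retype (retype ty r t) s u) =
    gr_bound (a + ((t == 2) + (u == 2))) (b + ((t == 1) + (u == 1))).
Proof.
move=> rs; exists (\sum_(i | (i != r) && (i != s)) (ty i == 2)).
exists (\sum_(i | (i != r) && (i != s)) (ty i == 1)).
have split_rs ty' t : nb_type t ty' =
    \sum_(i | (i != r) && (i != s)) (ty' i == t) + ((ty' r == t) + (ty' s == t)).
  rewrite /nb_type (bigD1 r) //= (bigD1 s) /=; last by rewrite eq_sym.
  by rewrite addnA addnC.
rewrite /type_bound !split_rs; split=> // t u.
rewrite !split_rs /retype !eqxx (negbTE rs).
by congr (gr_bound (_ + _) (_ + _)); apply: eq_bigr => i /andP[/negbTE-> /negbTE->].
Qed.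

(** * The induction step over a Gallai partition *)

Section Step.
Variables (S : {set V}) (ty : 'I_k -> nat) (X : {set 'I_k}).
Hypothesis ty2 : forall i, ty i <= 2.
Hypothesis aS : avoids ty S.
Hypothesis IH : forall P ty', #|P| < #|S| -> (forall i, ty' i <= 2) ->
  avoids ty' P -> #|P| <= type_bound ty'.
Hypothesis disc : ~~ connected c X S.
Hypothesis conn : forall i, i \notin X -> connected c (i |: X) S.
Local Notation e := (link c X S).
Local Notation part := (part c S X).

Lemma IH1 r t P : P \subset S -> #|P| < #|S| -> t <= 2 -> hfree (E r) t P ->
  #|P| <= type_bound (retype ty r t).
Proof.
move=> sPS ltPS t2 hP; apply: IH => //; first exact: retype_le2.
by apply: avoids_retype => // i; apply: hfreeS (aS i).
Qed.

Lemma IH2 r s t u P : P \subset S -> #|P| < #|S| -> t <= 2 -> u <= 2 ->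
  hfree (E r) t P -> hfree (E s) u P ->
  #|P| <= type_bound (retype (retype ty r t) s u).
Proof.
move=> sPS ltPS t2 u2 hr hs; apply: IH => //; first exact/retype_le2/retype_le2.
by do 2![apply: avoids_retype => //]; move=> i; apply: hfreeS (aS i).
Qed.

(** By [component_module] these vertices are joined in colour [i] to the whole part of [x], not only
    to [x]. *)
Definition cross_nbhd x i := [set y in S | ~~ connect e x y & c x y == i].

Lemma part_sub x : part x \subset S.
Proof. by apply/subsetP => y; rewrite inE => /andP[]. Qed.

Lemma cross_nbhd_sub x i : cross_nbhd x i \subset S.
Proof. by apply/subsetP => y; rewrite inE => /andP[]. Qed.

Lemma part_lt x : #|part x| < #|S|.
Proof.
have [y Sy nxy] := leave_part c_sym disc x; apply/proper_card/properP.
by split; [exact: part_sub | exists y; rewrite // inE Sy].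
Qed.

Lemma cross_nbhd_lt x i : x \in S -> #|cross_nbhd x i| < #|S|.
Proof.
move=> Sx; apply/proper_card/properP.
by split; [exact: cross_nbhd_sub | exists x; rewrite // inE connect0 andbF].
Qed.

Lemma cross_nbhd_neq0 x i : x \in S -> i \notin X -> cross_nbhd x i != set0.
Proof.
move=> Sx iX; have [y [Sy nxy cxy]] := part_neighbour c_sym gallai disc iX (conn iX) Sx.
by apply/set0Pn; exists y; rewrite inE Sy nxy cxy eqxx.
Qed.

Lemma part_join x i : {in part x & cross_nbhd x i, forall y z, E i y z}.
Proof.
move=> y z; rewrite !inE => /andP[Sy cxy] /and3P[Sz nxz /eqP cxz].
rewrite /colour_rel /= c_sym -(component_module c_sym gallai Sz nxz cxy).
rewrite c_sym cxz eqxx andbT; apply: contraNneq nxz => <-; exact: cxy.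
Qed.

Lemma kfree_part_nbhd p q x i : kfree (E i) (p + q) S ->
  kfree (E i) p (part x) || kfree (E i) q (cross_nbhd x i).
Proof. by apply: kfree_join; [exact: part_sub | exact: cross_nbhd_sub | exact: part_join]. Qed.

(** Any clique of the part extends by a vertex of the nonempty crossing neighbourhood. *)
Lemma part_kfree n x i : i \notin X -> x \in S -> kfree (E i) n.+1 S ->
  kfree (E i) n (part x).
Proof.
move=> iX Sx; rewrite -addn1 => /(@kfree_part_nbhd n 1 x); rewrite kfree1.
by rewrite (negbTE (cross_nbhd_neq0 Sx iX)) orbF.
Qed.

Lemma part_neq0 x : x \in S -> part x != set0.
Proof. by move=> Sx; apply/set0Pn; exists x; rewrite inE Sx connect0. Qed.

Lemma cross_type_gt0 i : i \notin X -> 0 < ty i.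
Proof.
move=> iX; rewrite lt0n; apply/eqP => ti.
case/forall_inPn: disc => x Sx _; have := aS i; rewrite ti.
by move/(part_kfree iX Sx); rewrite kfree1 (negbTE (part_neq0 Sx)).
Qed.

Lemma cross_kfree4 i : i \notin X -> ty i = 2 ->
  kfree (E i) 4 S || (#|S| <= 4).
Proof.
move=> iX ti; apply: (isolated_K4 c_sym gallai disc iX (conn iX)).
by have := aS i; rewrite ti.
Qed.

(** [S] is a part and its complement, completely joined in [r]. If [r] is triangle-free, neither
    side has an [r]-edge; if it is K_4-free, both sides are triangle-free and one has no
    [r]-edge. *)
Lemma one_crossing_colour r : r \notin X -> (forall i, i \notin X -> i = r) ->
  #|S| <= type_bound ty.
Proof.
move=> rX onlyr; have [a [b [-> bnd]]] := type_bound1 ty r.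
case/forall_inPn: (disc) => x Sx _.
have sS : #|S| = #|part x| + #|S :\: part x|.
  by rewrite -(cardsID (part x) S) (setIidPr (part_sub x)).
have DN : S :\: part x = cross_nbhd x r.
  apply/setP => y; rewrite !inE; case Sy: (y \in S) => //=; rewrite andbT.
  case nxy: (connect e x y) => //=.
  by rewrite (onlyr _ (cross_notin Sx Sy (negbT nxy))) ?eqxx.
rewrite sS DN.
have IHP t : t <= 2 -> hfree (E r) t (part x) ->
    #|part x| <= gr_bound (a + (t == 2)) (b + (t == 1)).
  by move=> t2; rewrite -bnd; apply: IH1 => //; [exact: part_sub | exact: part_lt].
have IHN t : t <= 2 -> hfree (E r) t (cross_nbhd x r) ->
    #|cross_nbhd x r| <= gr_bound (a + (t == 2)) (b + (t == 1)).
  by move=> t2; rewrite -bnd; apply: IH1 => //; [exact: cross_nbhd_sub | exact: cross_nbhd_lt].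
have kN n : kfree (E r) n.+1 S -> kfree (E r) n (cross_nbhd x r).
  by rewrite -add1n => /(@kfree_part_nbhd 1 n x); rewrite kfree1 (negbTE (part_neq0 Sx)).
have := cross_type_gt0 rX; have := aS r; have := ty2 r; have := @cross_kfree4 r rX.
case: (ty r) => [|[|[|//]]] //=.
  move=> _ _ f3 _.
  have := IHP 0 isT (part_kfree rX Sx f3); have := IHN 0 isT (kN 2 f3) => /= h1 h2.
  by apply: leq_trans (leq_add h2 h1) _; gr_bound_arith a b.
move=> /(_ erefl)/orP[f4|S4] _ _ _; last first.
  by rewrite -DN -sS; apply: leq_trans S4 _; gr_bound_arith a b.
have := IHP 1 isT (part_kfree rX Sx f4); have := IHN 1 isT (kN 3 f4) => /= h1 h2.
case/orP: (@kfree_part_nbhd 2 2 x r f4) => f2.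
  apply: leq_trans (leq_add (IHP 0 isT f2) h1) _; gr_bound_arith a b.
apply: leq_trans (leq_add h2 (IHN 0 isT f2)) _; gr_bound_arith a b.
Qed.

Definition crossing r s :=
  [/\ r != s, r \notin X, s \notin X & forall i, i \notin X -> i = r \/ i = s].

Lemma crossingC r s : crossing r s -> crossing s r.
Proof.
by case=> rs rX sX rsX; split=> //; [rewrite eq_sym | move=> i /rsX[]; [right | left]].
Qed.

Lemma card_part_nbhds r s x : crossing r s -> x \in S ->
  #|S| <= #|part x| + #|cross_nbhd x r| + #|cross_nbhd x s|.
Proof.
case=> _ _ _ rsX Sx; apply: leq_trans (leq_add (leq_card_setU _ _) (leqnn _)).
apply: leq_trans (leq_card_setU _ _); apply/subset_leq_card/subsetP => y Sy.
rewrite !inE Sy /=; have [//|nxy] := boolP (connect e x y).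
by have [->|->] := rsX _ (cross_notin Sx Sy nxy); rewrite eqxx ?orbT.
Qed.

(** The representatives form a complete graph in the colours [r] and [s], so there are at most [N]
    parts. *)
Lemma ramsey_parts p q N h r s : ramsey p q N -> crossing r s ->
  kfree (E r) p S -> kfree (E s) q S -> (forall x, x \in S -> #|part x| <= h) ->
  #|S| <= N * h.
Proof.
move=> R [_ _ _ rsX] fr fs hP; apply: leq_trans (leq_card_parts c_sym hP) _.
have sRS : reps c S X \subset S by apply/subsetP => y; rewrite inE => /andP[].
rewrite leq_mul2r (R _ (E r) (E s)) ?orbT //; try exact: colour_rel_sym;
  try exact: colour_rel_irr; try exact: kfreeS sRS _.
move=> x y rx ry xy; rewrite /colour_rel /= xy.
have nxy := reps_cross c_sym rx ry xy.
have [->|->] := rsX _ (cross_notin (subsetP sRS x rx) (subsetP sRS y ry) nxy).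
  by rewrite eqxx.
by rewrite eqxx orbT.
Qed.

(** No part has an edge of colour [r] or [s], and R(3,3) <= 6 leaves at most 5 parts. *)
Lemma two_triangle_colours r s : crossing r s -> ty r = 1 -> ty s = 1 ->
  #|S| <= type_bound ty.
Proof.
move=> crs tr ts; have [rs rX sX _] := crs.
have [a [b [-> bnd]]] := type_bound2 ty rs; rewrite tr ts /=.
have [fr fs] := (aS r, aS s); rewrite tr in fr.
rewrite ts in fs.
have := ramsey_parts ramsey33 crs fr fs (h := gr_bound (a + 0) (b + 0)).
move=> /(_ _)/leq_trans->//; last by gr_bound_arith a b.
move=> x Sx; rewrite -(bnd 0 0); apply: IH2; rewrite ?part_sub ?part_lt //.
  exact: part_kfree fr.
exact: part_kfree fs.
Qed.

(** If no part has an [r]-edge, R(4,3) <= 9 leaves at most 8 parts, all free of both colours.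
    Otherwise a part with an [r]-edge has no [r]-edge among its [r]-neighbours, and [S] is covered
    by this part and its two neighbourhoods. *)
Lemma K4_triangle_colours r s : crossing r s -> ty r = 2 -> ty s = 1 ->
  #|S| <= type_bound ty.
Proof.
move=> crs tr ts; have [rs rX sX _] := crs.
have [a [b [-> bnd]]] := type_bound2 ty rs; rewrite tr ts /=.
have [hr fs] := (aS r, aS s); rewrite tr /= in hr.
rewrite ts in fs.
have /orP[fr|S4] := cross_kfree4 rX tr; last first.
  by apply: leq_trans S4 _; gr_bound_arith a b.
have [/forall_inP all2 | /forall_inPn[x Sx nf2]] :=
    boolP [forall x in S, kfree (E r) 2 (part x)].
  have := ramsey_parts ramsey43 crs fr fs (h := gr_bound (a + 0) (b + 0)).
  move=> /(_ _)/leq_trans->//; last by gr_bound_arith a b.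
  move=> x Sx; rewrite -(bnd 0 0); apply: IH2; rewrite ?part_sub ?part_lt //.
    exact: all2.
  exact: part_kfree fs.
have hP : #|part x| <= gr_bound (a + 0) (b + 1).
  rewrite -(bnd 1 0); apply: IH2; rewrite ?part_sub ?part_lt //.
    exact: part_kfree fr.
  exact: part_kfree fs.
have hr' : #|cross_nbhd x r| <= gr_bound (a + 0) (b + 1).
  rewrite -(bnd 0 1); apply: IH2; rewrite ?cross_nbhd_sub ?cross_nbhd_lt //.
    by have := @kfree_part_nbhd 2 2 x r fr; rewrite (negbTE nf2).
  exact: kfreeS (cross_nbhd_sub x r) fs.
have hs' : #|cross_nbhd x s| <= gr_bound (a + 1) (b + 0).
  rewrite -(bnd 2 0); apply: IH2; rewrite ?cross_nbhd_sub ?cross_nbhd_lt //.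
    exact: K4e_freeS (cross_nbhd_sub x s) hr.
  have := @kfree_part_nbhd 1 2 x s fs.
  by rewrite kfree1 (negbTE (part_neq0 Sx)).
apply: leq_trans (card_part_nbhds crs Sx) _.
apply: leq_trans (leq_add (leq_add hP hr') hs') _; gr_bound_arith a b.
Qed.

(* The induction hypothesis alone is too weak on the [r]-neighbourhood [N] of
   [part x]: crossing edges inside [N] all have colour [s], so cutting off one
   part of [N] leaves one side free of [s]. *)
Lemma K4_K4_unbalanced r s x : crossing r s -> ty r = 2 -> ty s = 2 ->
  kfree (E r) 4 S -> kfree (E s) 4 S -> x \in S ->
  ~~ kfree (E r) 2 (part x) -> kfree (E s) 2 (part x) -> #|S| <= type_bound ty.
Proof.
move=> crs tr ts fr fs Sx nfr2 fs2; have [rs rX sX rsX] := crs.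
have [a [b [-> bnd]]] := type_bound2 ty rs; rewrite tr ts /=.
have hr := aS r; rewrite tr /= in hr.
have hP : #|part x| <= gr_bound (a + 0) (b + 1).
  rewrite -(bnd 1 0); apply: IH2; rewrite ?part_sub ?part_lt //.
  exact: part_kfree fr.
have hs' : #|cross_nbhd x s| <= gr_bound (a + 1) (b + 1).
  rewrite -(bnd 2 1); apply: IH2; rewrite ?cross_nbhd_sub ?cross_nbhd_lt //.
    exact: K4e_freeS (cross_nbhd_sub x s) hr.
  have := @kfree_part_nbhd 1 3 x s fs.
  by rewrite kfree1 (negbTE (part_neq0 Sx)).
have N2 : kfree (E r) 2 (cross_nbhd x r).
  by have := @kfree_part_nbhd 2 2 x r fr; rewrite (negbTE nfr2).
have [y Ny] : exists y, y \in cross_nbhd x r by apply/set0Pn/cross_nbhd_neq0.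
have Sy := subsetP (cross_nbhd_sub x r) y Ny.
set N := cross_nbhd x r in N2 Ny.
have sI : N :&: part y \subset S by apply: subset_trans (part_sub y); apply: subsetIr.
have sD : N :\: part y \subset S.
  by apply: subset_trans (cross_nbhd_sub x r); apply: subsetDl.
have ltI : #|N :&: part y| < #|S|.
  by apply: leq_ltn_trans (part_lt y); apply/subset_leq_card/subsetIr.
have ltD : #|N :\: part y| < #|S|.
  by apply: leq_ltn_trans (cross_nbhd_lt r Sx); apply/subset_leq_card/subsetDl.
have jID : {in N :&: part y & N :\: part y, forall u w, E s u w}.
  move=> u w /setIP[Nu yu] /setDP[Nw nyw].
  have Sw := subsetP (cross_nbhd_sub x r) w Nw.
  move: yu; rewrite inE => /andP[Su cyu]; rewrite inE Sw /= in nyw.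
  have nuw : ~~ connect e u w by apply: contra nyw; apply: connect_trans.
  rewrite /colour_rel /= (cross_neq nuw).
  have [cr|->] := rsX _ (cross_notin Su Sw nuw); last by rewrite eqxx.
  by have := kfree2_edge N2 Nu Nw; rewrite /colour_rel /= cr eqxx (cross_neq nuw).
have I0 : N :&: part y != set0.
  by apply/set0Pn; exists y; rewrite in_setI Ny inE Sy connect0.
have I3 : kfree (E s) 3 (N :&: part y).
  by apply: kfreeS (subsetIr _ _) _; apply: part_kfree.
have D3 : kfree (E s) 3 (N :\: part y).
  have := @kfree_join _ _ 1 3 _ _ _ sI sD jID fs; rewrite kfree1.
  by rewrite (negbTE I0).
have I2 := kfreeS (subsetIl N (part y)) N2.
have D2 := kfreeS (subsetDl N (part y)) N2.
have hI := @IH2 r s 0 1 _ sI ltI isT isT I2 I3; rewrite bnd /= in hI.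
have hD := @IH2 r s 0 1 _ sD ltD isT isT D2 D3; rewrite bnd /= in hD.
have hN : #|N| <= gr_bound (a + 0) (b + 0) + gr_bound (a + 0) (b + 1).
  rewrite -(cardsID (part y) N).
  case/orP: (@kfree_join _ _ 2 2 _ _ _ sI sD jID fs) => f2.
    apply: leq_add hD.
    by have := @IH2 r s 0 0 _ sI ltI isT isT I2 f2; rewrite bnd.
  rewrite addnC; apply: leq_add hI.
  by have := @IH2 r s 0 0 _ sD ltD isT isT D2 f2; rewrite bnd.
apply: leq_trans (card_part_nbhds crs Sx) _.
apply: leq_trans (leq_add (leq_add hP hN) hs') _; gr_bound_arith a b.
Qed.

(** If all parts are free of both colours, R(4,4) <= 18 leaves at most 17 of them. A part with edges
    of just one colour is the unbalanced case. *)
Lemma two_K4_colours r s : crossing r s -> ty r = 2 -> ty s = 2 ->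
  #|S| <= type_bound ty.
Proof.
move=> crs tr ts; have [rs rX sX _] := crs.
have [a [b [Eb bnd]]] := type_bound2 ty rs; rewrite tr ts /= in Eb.
have [hr hs] := (aS r, aS s); rewrite tr /= in hr; rewrite ts /= in hs.
have /orP[fr|S4] := cross_kfree4 rX tr; last first.
  by rewrite Eb; apply: leq_trans S4 _; gr_bound_arith a b.
have /orP[fs|S4] := cross_kfree4 sX ts; last first.
  by rewrite Eb; apply: leq_trans S4 _; gr_bound_arith a b.
have [/forall_inP all2 | /forall_inPn[x Sx]] :=
    boolP [forall x in S, kfree (E r) 2 (part x) && kfree (E s) 2 (part x)].
  rewrite Eb.
  have := ramsey_parts ramsey44 crs fr fs (h := gr_bound (a + 0) (b + 0)).
  move=> /(_ _)/leq_trans->//; last by gr_bound_arith a b.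
  move=> x Sx; rewrite -(bnd 0 0).
  by case/andP: (all2 x Sx) => r2 s2; apply: IH2; rewrite ?part_sub ?part_lt.
have [r2|nr2] := boolP (kfree (E r) 2 (part x)).
  by move=> ns2; apply: (K4_K4_unbalanced (crossingC crs)) Sx _ _.
have [s2 _|ns2 _] := boolP (kfree (E s) 2 (part x)).
  by apply: (K4_K4_unbalanced crs) Sx _ _.
(* The part has edges of both colours, so each of its two neighbourhoods loses its own colour
   entirely. *)
have hP : #|part x| <= gr_bound (a + 0) (b + 2).
  rewrite -(bnd 1 1); apply: IH2; rewrite ?part_sub ?part_lt //.
    exact: part_kfree fr.
  exact: part_kfree fs.
have hr' : #|cross_nbhd x r| <= gr_bound (a + 1) (b + 0).
  rewrite -(bnd 0 2); apply: IH2; rewrite ?cross_nbhd_sub ?cross_nbhd_lt //.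
    by have := @kfree_part_nbhd 2 2 x r fr; rewrite (negbTE nr2).
  exact: K4e_freeS (cross_nbhd_sub x r) hs.
have hs' : #|cross_nbhd x s| <= gr_bound (a + 1) (b + 0).
  rewrite -(bnd 2 0); apply: IH2; rewrite ?cross_nbhd_sub ?cross_nbhd_lt //.
    exact: K4e_freeS (cross_nbhd_sub x s) hr.
  by have := @kfree_part_nbhd 2 2 x s fs; rewrite (negbTE ns2).
rewrite Eb; apply: leq_trans (card_part_nbhds crs Sx) _.
apply: leq_trans (leq_add (leq_add hP hr') hs') _; gr_bound_arith a b.
Qed.

Lemma two_crossing_colours r s : crossing r s -> #|S| <= type_bound ty.
Proof.
move=> crs; have [_ rX sX _] := crs.
have := cross_type_gt0 sX; have := cross_type_gt0 rX; have := ty2 s; have := ty2 r.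
case tr: (ty r) => [|[|[|//]]] //; case ts: (ty s) => [|[|[|//]]] // _ _ _ _.
- exact: two_triangle_colours crs tr ts.
- exact: K4_triangle_colours (crossingC crs) ts tr.
- exact: K4_triangle_colours crs tr ts.
- exact: two_K4_colours crs tr ts.
Qed.

End Step.

Lemma gallai_card_bound ty S : (forall i, ty i <= 2) -> avoids ty S ->
  #|S| <= type_bound ty.
Proof.
have [n leSn] := ubnP #|S|; elim: n S ty leSn => // n IHn S ty leSn ty2 aS.
have [S1|S1] := ltnP 1 #|S|; last first.
  exact: leq_trans S1 (gr_bound_gt0 _ _).
have [X [dX cX X2]] := gallai_partition c_sym gallai S1.
have IH P ty' : #|P| < #|S| -> (forall i, ty' i <= 2) -> avoids ty' P ->
    #|P| <= type_bound ty'.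
  by move=> ltPS; apply: IHn; apply: leq_trans ltPS _.
have X0 : #|~: X| != 0.
  apply/negP => /eqP/cards0_eq/setP X0.
  case/forall_inPn: (dX) => x Sx _; have [y Sy nxy] := leave_part c_sym dX x.
  by have := cross_notin Sx Sy nxy; have := X0 (c x y); rewrite !inE => ->.
have [/eqP/cards1P[r Xr] | /eqP/cards2P[r [s [rs Xrs]]]] :
    #|~: X| = 1 \/ #|~: X| = 2 by lia.
  have inX i : (i \notin X) = (i == r) by have /setP/(_ i) := Xr; rewrite !inE.
  apply: (one_crossing_colour ty2 aS IH dX cX (r := r)); first by rewrite inX.
  by move=> i; rewrite inX => /eqP.
have inX i : (i \notin X) = (i == r) || (i == s).
  by have /setP/(_ i) := Xrs; rewrite !inE.
apply: (two_crossing_colours ty2 aS IH dX cX (r := r) (s := s)).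
split; rewrite ?inX ?eqxx ?orbT // => i; rewrite inX.
by case/orP => /eqP; [left | right].
Qed.

End Bound.

(** * From edge colourings to colours of pairs *)

Lemma edge_neq N (f : edge (complete N)) x y : val f = [set x; y] -> x != y.
Proof.
case: f => s /= /existsP[u /existsP[v /andP[uv /eqP->]]] E.
have {}uv : u != v := uv.
by have := cards2 u v; rewrite E cards2 uv => /eqP; case: (x != y).
Qed.

Lemma complete_edge N (x y : 'I_N) : x != y -> is_edge (G := complete N) [set x; y].
Proof. by move=> xy; apply/existsP; exists x; apply/existsP; exists y; rewrite eqxx andbT. Qed.

Section UpperBound.
Variables (k N : nat) (c : edge_coloring k.+1 (complete N)).

(** The default [ord0] is taken only on the diagonal. *)
Definition pair_colour (x y : 'I_N) : 'I_k.+1 :=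
  if insub [set x; y] is Some f then c f else ord0.

Lemma pair_colourE (f : edge (complete N)) x y :
  val f = [set x; y] -> pair_colour x y = c f.
Proof. by rewrite /pair_colour => <-; rewrite valK. Qed.

Lemma pair_colourC x y : pair_colour x y = pair_colour y x.
Proof. by rewrite /pair_colour setUC. Qed.

Lemma pair_colour_gallai : gallai_coloring c -> forall x y z,
  x != y -> y != z -> x != z ->
  [\/ pair_colour x y = pair_colour y z, pair_colour y z = pair_colour x z
    | pair_colour x y = pair_colour x z].
Proof.
move=> gc x y z xy yz xz.
pose f1 : edge (complete N) := Sub _ (complete_edge xy).
pose f2 : edge (complete N) := Sub _ (complete_edge yz).
pose f3 : edge (complete N) := Sub _ (complete_edge xz).
rewrite (pair_colourE (f := f1)) // (pair_colourE (f := f2)) //.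
rewrite (pair_colourE (f := f3)) //.
have [->|n12] := eqVneq (c f1) (c f2); first by constructor 1.
have [->|n23] := eqVneq (c f2) (c f3); first by constructor 2.
have [->|n13] := eqVneq (c f1) (c f3); first by constructor 3.
case: gc; exists x, y, z, f1, f2, f3; split=> //=.
by rewrite !inE negb_or n12 n13 n23.
Qed.

Lemma mono_copy_K4e i (K : {set 'I_N}) w u : #|K| = 4 ->
  clique (colour_rel pair_colour i) K -> w \in K -> u \notin K ->
  colour_rel pair_colour i w u -> mono_copy K4e c.
Proof.
(* The order puts [w] at index 3 and [u] at index 4, the ends of the pendant edge of [K4e]. *)
move=> cK clK Kw Ku Ewu; pose s := enum (K :\ w) ++ [:: w; u].
have sz : size (enum (K :\ w)) = 3.
  by rewrite -cardE; have := cardsD1 w K; rewrite cK Kw => -[].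
have us : uniq s.
  rewrite cat_uniq enum_uniq /= !inE !mem_enum !inE eqxx /= (negbTE Ku) andbF /=.
  by rewrite andbT; apply: contraNneq Ku => <-.
have szs : size s = 5 by rewrite size_cat sz.
pose f (j : 'I_5) := nth u s j.
have f_inj : injective f.
  by move=> j l /eqP; rewrite nth_uniq ?szs // => /eqP/ord_inj.
have f3 (j : 'I_5) : j = 3 :> nat -> f j = w.
  by move=> j3; rewrite /f j3 nth_cat sz.
have f4 (j : 'I_5) : j = 4 :> nat -> f j = u.
  by move=> j4; rewrite /f j4 nth_cat sz.
have fK (j : 'I_5) : j < 4 -> f j \in K.
  rewrite ltnS leq_eqVlt => /orP[/eqP/f3-> // | j3].
  have : f j \in enum (K :\ w) by rewrite /f nth_cat sz j3 mem_nth ?sz.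
  by rewrite mem_enum inE => /andP[].
have col j l : K4e_adj j l -> colour_rel pair_colour i (f j) (f l).
  case/or3P => [/and3P[jl j4 l4] | /andP[/eqP j3 /eqP l4] | /andP[/eqP j4 /eqP l3]].
  - by apply: clK; rewrite ?fK // (inj_eq f_inj).
  - by rewrite (f3 j) // (f4 l).
  - by rewrite (f4 j) // (f3 l) // (colour_rel_sym pair_colourC).
exists f, i; split=> // j l /col /andP[jl /eqP cE].
by exists (Sub _ (complete_edge jl)); rewrite //= -cE; apply/esym/pair_colourE.
Qed.

End UpperBound.

Lemma gallai_arrows_bound k N : gr_bound k.+1 0 < N -> gallai_arrows k.+1 K4e N.
Proof.
move=> ltN c gc.
case: (boolP [exists i, exists K : {set 'I_N}, exists w, exists u,
  [&& #|K| == 4, [forall x in K, forall y in K, (x != y) ==> colour_rel (pair_colour c) i x y],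
      w \in K, u \notin K & colour_rel (pair_colour c) i w u]]).
  case/existsP => i /existsP[K /existsP[w /existsP[u]]].
  case/and5P => /eqP cK /forall_inP clK Kw Ku Ewu.
  apply: (mono_copy_K4e cK) Kw Ku Ewu => x y Kx Ky xy.
  by have /forall_inP/(_ y Ky)/implyP := clK x Kx; apply.
move=> /existsPn noK; suff : N <= gr_bound k.+1 0 by rewrite leqNgt ltN.
have av : avoids (pair_colour c) (fun=> 2) [set: 'I_N].
  move=> i K _ cK clK w u Kw _ Ewu; apply: contraT => Ku.
  have /existsPn/(_ K)/existsPn/(_ w)/existsPn/(_ u) := noK i.
  rewrite cK Kw Ku Ewu !andbT /= => /forall_inPn[x Kx /forall_inPn[y Ky]].
  by rewrite negb_imply => /andP[xy]; rewrite clK.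
have := gallai_card_bound (ty := fun=> 2) (@pair_colourC _ _ c) (pair_colour_gallai gc)
  (fun=> isT) av.
rewrite cardsT card_ord /type_bound /nb_type !sum_nat_const card_ord.
by rewrite muln0 muln1.
Qed.

(** * The lower bound *)

(** The list consists of the nonzero squares modulo 17; adding 17 avoids truncated subtraction. *)
Definition paley a b := (a + 17 - b) %% 17 \in [:: 1; 2; 4; 8; 9; 13; 15; 16].

(** Holds because -1 is a square modulo 17; checked by computation. *)
Lemma paleyC a b : a < 17 -> b < 17 -> paley a b = paley b a.
Proof.
have chk : all (fun a => all (fun b => paley a b == paley b a) (iota 0 17)) (iota 0 17).
  by vm_compute.
move=> a17 b17; apply/eqP; have /allP/(_ a) := chk; rewrite mem_iota => /(_ a17).
by move/allP/(_ b); rewrite mem_iota; apply.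
Qed.

Definition paley_K4 (t : bool) a b c d :=
  [&& uniq [:: a; b; c; d], paley a b == t, paley a c == t, paley a d == t,
      paley b c == t, paley b d == t & paley c d == t].

Lemma paley_K4_free t a b c d :
  a < 17 -> b < 17 -> c < 17 -> d < 17 -> ~~ paley_K4 t a b c d.
Proof.
have chk : all (fun a => all (fun b => all (fun c => all (fun d =>
    ~~ paley_K4 true a b c d && ~~ paley_K4 false a b c d)
  (iota 0 17)) (iota 0 17)) (iota 0 17)) (iota 0 17) by vm_compute.
move=> a17 b17 c17 d17.
have /allP/(_ a) := chk; rewrite mem_iota => /(_ a17).
move=> /allP/(_ b); rewrite mem_iota => /(_ b17).
move=> /allP/(_ c); rewrite mem_iota => /(_ c17).
move=> /allP/(_ d); rewrite mem_iota => /(_ d17) /andP[].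
by case: t.
Qed.

(* [m] nested Paley colourings of order 17; the vertices inside the innermost
   copies are joined in colour [d], which is used nowhere else. *)
Fixpoint blowup d m x y :=
  if m is m'.+1 then
    if x %% 17 == y %% 17 then blowup d m' (x %/ 17) (y %/ 17)
    else m'.*2 + paley (x %% 17) (y %% 17)
  else d.

Lemma blowupC d m x y : blowup d m x y = blowup d m y x.
Proof.
elim: m x y => //= m IHm x y; rewrite eq_sym IHm.
by rewrite [paley _ _]paleyC // ltn_mod.
Qed.

Lemma blowup_cases d m x y : blowup d m x y < m.*2 \/ blowup d m x y = d.
Proof.
elim: m x y => [|m IHm] x y /=; first by right.
case: eqP => _; last by left; case: (paley _ _); lia.
by case: (IHm (x %/ 17) (y %/ 17)); [left; lia | right].
Qed.

Lemma blowup_lt d m x y : x < 17 ^ m -> y < 17 ^ m -> x != y ->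
  blowup d m x y < m.*2.
Proof.
elim: m x y => [|m IHm] x y /=; first by case: x y => [|?] [|?].
rewrite expnSr -!ltn_divLR // => xm ym xy.
case: eqVneq => [E|_]; last by case: (paley _ _); lia.
have : blowup d m (x %/ 17) (y %/ 17) < m.*2 by apply: IHm => //; lia.
lia.
Qed.

(** If exactly two residues agree, the third vertex sees both in one colour; if all differ, only the
    two colours of this level occur. *)
Lemma blowup_gallai d m x y z :
  [\/ blowup d m x y = blowup d m y z, blowup d m y z = blowup d m x z
    | blowup d m x y = blowup d m x z].
Proof.
elim: m x y z => [|m IHm] x y z /=; first by constructor 1.
have [xy|xy] := eqVneq (x %% 17) (y %% 17).
  by rewrite xy; case: ifP => _; [apply: IHm | constructor 2].
have [yz|yz] := eqVneq (y %% 17) (z %% 17).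
  by constructor 3; rewrite -yz (negbTE xy).
have [xz|xz] := eqVneq (x %% 17) (z %% 17).
  by constructor 1; rewrite -xz paleyC ?ltn_mod.
case: (paley (x %% 17) (y %% 17)); case: (paley (y %% 17) (z %% 17));
  case: (paley (x %% 17) (z %% 17)); by [constructor 1 | constructor 2 | constructor 3].
Qed.

(** If [i] belongs to the outermost level, the K_4 projects to a monochromatic K_4 of the Paley
    colouring. Otherwise the connected graph [K4e] lies in one residue class and descends a level.
    At the bottom five vertices do not fit into [n <= 4]. *)
Lemma blowup_K4e_free d m n i (f : 'I_5 -> nat) : n <= 4 -> m.*2 <= d ->
  injective f -> (forall j, f j < n * 17 ^ m) ->
  (forall j l, K4e_adj j l -> blowup d m (f j) (f l) = i) -> False.
Proof.
move=> n4; elim: m f => [|m IHm] f md f_inj f_lt f_col.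
  have f4 j : f j < 4 by apply: leq_trans (f_lt j) _; rewrite muln1.
  have g_inj : injective (fun j => Ordinal (f4 j)) by move=> j l [/f_inj].
  by have := leq_card _ g_inj; rewrite !card_ord.
have [i_m|i_m] := boolP ((i == m.*2) || (i == m.*2.+1)).
  (* Inside a residue class colours are below [m.*2] or equal to [d], and [m.+1.*2 <= d] keeps both
     apart from [i]. *)
  have neq j l : K4e_adj j l -> f j %% 17 != f l %% 17.
    move=> jl; apply/negP => E; have := f_col _ _ jl; rewrite /= E => ci.
    by case: (blowup_cases d m (f j %/ 17) (f l %/ 17)); rewrite ci; lia.
  have colp j l : K4e_adj j l -> paley (f j %% 17) (f l %% 17) == (i == m.*2.+1).
    move=> jl; have := f_col _ _ jl; rewrite /= (negbTE (neq _ _ jl)) => <-.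
    by case: (paley _ _); lia.
  pose o j (lt : j < 5) := Ordinal lt.
  have := @paley_K4_free (i == m.*2.+1) (f (@o 0 isT) %% 17) (f (@o 1 isT) %% 17)
    (f (@o 2 isT) %% 17) (f (@o 3 isT) %% 17).
  rewrite !ltn_mod => /(_ isT isT isT isT)/negP; apply.
  by rewrite /paley_K4 !colp // /= !inE !negb_or !neq.
have eq17 j l : K4e_adj j l -> f j %% 17 = f l %% 17.
  move=> jl; apply/eqP; apply: contraNT i_m => nE; have := f_col _ _ jl.
  by rewrite /= (negbTE nE) => <-; case: (paley _ _); rewrite ?addn0 ?addn1 eqxx ?orbT.
(* Vertex 3 carries the pendant edge, hence is adjacent to all the others. *)
pose o3 : 'I_5 := Ordinal (isT : 3 < 5).
have all17 j : f j %% 17 = f o3 %% 17.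
  have [-> //|j3] := eqVneq j o3; apply: eq17; rewrite /K4e_adj j3 /=.
  by case: j j3 => [[|[|[|[|[|]]]]] ?].
apply: (IHm (fun j => f j %/ 17)).
- lia.
- by move=> j l E; apply: f_inj; rewrite (divn_eq (f j) 17) E all17 -(all17 l) -divn_eq.
- by move=> j; rewrite ltn_divLR // -mulnA -expnSr.
by move=> j l jl; rewrite -(f_col _ _ jl) /= (eq17 _ _ jl) eqxx.
Qed.

Section EdgeColouring.
Variables (k M : nat) (col : nat -> nat -> nat).
Hypothesis colC : forall x y, col x y = col y x.

(** An edge is an unordered pair, so some ordering is picked; [colC] makes the choice immaterial. *)
Definition edge_colour : edge_coloring k.+1 (complete M) := fun f =>
  if [pick p : 'I_M * 'I_M | val f == [set p.1; p.2]] is Some p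
  then inord (col p.1 p.2) else ord0.

Lemma edge_colourE (f : edge (complete M)) (x y : 'I_M) :
  val f = [set x; y] -> edge_colour f = inord (col x y).
Proof.
move=> fE; rewrite /edge_colour; case: pickP => [[u v] /= /eqP fE' | /(_ (x, y))]; last first.
  by rewrite /= fE eqxx.
have xy := edge_neq fE; have uv := edge_neq fE'; rewrite fE in fE'.
have : x \in [set u; v] by rewrite -fE' set21.
have : y \in [set u; v] by rewrite -fE' set22.
rewrite !inE => /orP[/eqP yE | /eqP yE] /orP[/eqP xE | /eqP xE]; subst.
- by rewrite eqxx in xy.
- by rewrite colC.
- by [].
- by rewrite eqxx in xy.
Qed.

End EdgeColouring.

Lemma gr_bound_arrows k M : gallai_arrows k.+1 K4e M -> gr_bound k.+1 0 < M.
Proof.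
move=> arr; rewrite ltnNge; apply/negP => leM.
pose n := if odd k.+1 then 4 else 1; pose m := k.+1./2.
have vlt (x : 'I_M) : x < n * 17 ^ m.
  apply: leq_trans (ltn_ord x) (leq_trans leM _).
  by rewrite /gr_bound (_ : 5 ^ 0./2 * _ = 1) // muln1 mulnC.
have kE : k.+1 = odd k.+1 + m.*2 by rewrite odd_double_half.
(* For an odd number of colours, [m.*2] is the last one. For an even number it is out of range, but
   distinct vertices below [17 ^ m] differ in some base-17 digit and never receive it. *)
have clt (x y : 'I_M) : x != y -> blowup m.*2 m x y < k.+1.
  move=> xy; have := vlt x; have := vlt y; move: kE; rewrite /n.
  case: (odd k.+1) => kE; last first.
    by rewrite !mul1n => xm ym; rewrite [X in _ < X]kE; apply: blowup_lt.
  move=> _ _; rewrite [X in _ < X]kE.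
  by case: (blowup_cases m.*2 m x y); lia.
pose c := @edge_colour k M (blowup m.*2 m).
have cE (f : edge (complete M)) (x y : 'I_M) : val f = [set x; y] ->
    val (c f) = blowup m.*2 m x y.
  move=> fE; rewrite /c (edge_colourE k (blowupC _ _) fE) /= inordK //.
  exact: clt (edge_neq fE).
have gc : gallai_coloring c.
  case=> x [y [z [f1 [f2 [f3 [E1 E2 E3]]]]]] /=.
  rewrite !inE negb_or -!(inj_eq val_inj) (cE _ _ _ E1) (cE _ _ _ E2) (cE _ _ _ E3).
  by case: (blowup_gallai m.*2 m x y z) => ->; rewrite eqxx ?andbF.
have [f [i [f_inj f_col]]] := arr c gc.
apply: (@blowup_K4e_free m.*2 m n (val i) (fun j => val (f j))) => //.
- by rewrite /n; case: odd.
- by move=> j l /val_inj/f_inj.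
- by move=> j; apply: vlt.
by move=> j l /f_col[g gE <-]; rewrite (cE _ _ _ gE).
Qed.

Unset Implicit Arguments.

Theorem theorem1p7 (k : nat) (hk : 1 <= k) :
  is_GR k K4e
    (if odd k then 4 * 17 ^ ((k - 1) %/ 2) + 1 else 17 ^ (k %/ 2) + 1).
Proof.
case: k hk => // k _.
have -> : (if odd k.+1 then 4 * 17 ^ ((k.+1 - 1) %/ 2) + 1
           else 17 ^ (k.+1 %/ 2) + 1) = (gr_bound k.+1 0).+1.
  rewrite /gr_bound (_ : 5 ^ 0./2 * _ = 1) // muln1 !divn2 !addn1.
  case: ifP => [odd_k|_]; last by rewrite muln1.
  by rewrite mulnC; congr (_ ^ _ * _).+1; lia.
split; first exact: gallai_arrows_bound.
exact: gr_bound_arrows.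
Qed.
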